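(* Let $\mathcal{S}$ be the multiplicative semigroup of positive rational numbers generated by $\{2\}\cup\left\{\frac{2k+1}{3k+2} : k\in\mathbb{Z},\ k\ge 0\right\}$. Then $\mathcal{S}$ equals the set of all positive rationals $\frac{a}{b}$ in lowest terms (with $a,b$ positive integers, $\gcd(a,b)=1$) having the property that $b\not\equiv 0 \pmod 3$. In particular, $\mathcal{S}$ contains every positive integer.
   Context: The multiplicative semigroup generated by a set $G$ of positive rationals is the set of all finite products of one or more (not necessarily distinct) elements of $G$. The semigroup $\mathcal{S}=\langle 2,\frac12,\frac35,\frac58,\frac7{11},\dots\rangle$ is called the $3x+1$ semigroup. *)

(* Defs.v *)
From mathcomp Require Import all_boot all_order all_algebra.

Set Implicit Arguments.
Unset Strict Implicit.
Unset Printing Implicit Defensive.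

Import GRing.Theory.
Local Open Scope ring_scope.

Definition semigroup_gen (G : rat -> Prop) (x : rat) : Prop :=
  exists s : seq rat,
    [/\ s <> [::], forall g : rat, g \in s -> G g & x = \prod_(g <- s) g].

Definition gen3x1 (g : rat) : Prop :=
  g = 2 \/ exists k : nat, g = (2 * k + 1)%N%:R / (3 * k + 2)%N%:R.

Definition semigroup3x1 : rat -> Prop := semigroup_gen gen3x1.

(* Main.v *)
Require Import Defs.
From Stdlib Require Import BinNat Nnat.
From mathcomp Require Import all_boot all_order all_algebra.
From mathcomp Require Import zify ring.

Set Implicit Arguments.
Unset Strict Implicit.
Unset Printing Implicit Defensive.

Import GRing.Theory.
Local Open Scope ring_scope.

(** A denominator prime to 3 is forced, since no generator has a denominator
    divisible by 3.  For the converse, write a -> b when a/b lies in the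
    semigroup S.  This relation is transitive and compatible with products,
    2n and n lead to each other, and an odd n leads to 3n + 1.  Everything
    follows once each n > 0 is tame (n -> 1: [tame_all]) and each n > 0 prime
    to 3 is wild (1 -> n: [wild_all]).  The two families are bootstrapped from
    one another.

    Tame from wild.  If m is wild then x -> xm -> 3xm + 1 for odd xm, so a
    Collatz step may be preceded by a multiplication by any wild m.  With a few
    small wild multipliers, every odd n > 1 outside the class of -1 modulo 1024
    leads to a smaller number ([descends_mod1024], a finite computation on
    residues).  If n = 2^j u - 1 with u odd and j >= 10, take for m the integer
    (2^k + 1)/3: the step turns 2^k y - 1 into (2^k + 1) y - 1
    ([leads_peel]), that is, it removes k factors 2 at the price of a factor
    1 + 2^-k only.  Split j into at most 15 such exponents k >= 5: the result is
    P u - 1 with P odd and P < 2^(j+1), an even number whose half is smaller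
    than n.  Thus wildness of the numbers (2^k + 1)/3 for k < K + 10 makes all
    n < 2^(12 K + 10) tame ([tame_of_peelable]).

    Wild from tame.  If d is odd and wild and 3d + 1 = nM with M tame, then
    1 -> d -> nM -> n.  Such a d exists among the products of at most 5 wild
    numbers below n: the residue -1/3 modulo n is a product of fractions such
    as -2, 1/2, 3/2 or 1/9, each represented by an integer below n that is
    prime to 6, like n - 2, (n + 1)/2, (n + 3)/2 or (2n + 1)/9
    ([represents_third]).  Then M <= 3 n^4.

    The bootstrap closes because K may be taken as large as log2 n, up to a
    bounded amount, so that wild numbers below n make tame all numbers up to
    about n^12, which is far beyond 3 n^4 ([tame_of_wild_below]).  It starts from
    explicit relations, the first being the cycle 5 -> 7 -> 11 -> 17 -> 13 -> 5 together
    with 7 * 7 * 17 -> 5^4, which yields 5^3 -> 5^4 and hence 1 -> 5. *)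

(** * Quotients in the semigroup *)

Lemma semigroup3x1_gen g : gen3x1 g -> semigroup3x1 g.
Proof.
by move=> Gg; exists [:: g]; split=> // [h|]; rewrite ?big_seq1 // inE => /eqP->.
Qed.

Lemma semigroup3x1_mul x y :
  semigroup3x1 x -> semigroup3x1 y -> semigroup3x1 (x * y).
Proof.
move=> [s [s0 Gs ->]] [t [_ Gt ->]]; exists (s ++ t); split.
- by case: s s0 {Gs}.
- by move=> g; rewrite mem_cat => /orP[/Gs|/Gt].
- by rewrite big_cat.
Qed.

(** Positivity is part of the relation, because the division of rationals is
    total and x / 0 = 0. *)
Definition leads (a b : nat) : Prop :=
  [/\ (0 < a)%N, (0 < b)%N & semigroup3x1 (a%:R / b%:R)].

Local Open Scope nat_scope.

Lemma natr_neq0 n : 0 < n -> (n%:R != 0 :> rat)%R.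
Proof. by rewrite Num.Theory.pnatr_eq0 -lt0n. Qed.

Lemma leads_eq a b c d :
  0 < c -> 0 < d -> a * d = b * c -> leads a b -> leads c d.
Proof.
move=> c0 d0 e [a0 b0 S]; split=> //.
suff -> : (c%:R / d%:R = a%:R / b%:R :> rat)%R by [].
apply/eqP; rewrite eqr_div ?natr_neq0 // -!natrM; apply/eqP; congr (_%:R)%R; lia.
Qed.

Lemma leads_mul a b c d : leads a b -> leads c d -> leads (a * c) (b * d).
Proof.
move=> [a0 b0 S] [c0 d0 T]; split; rewrite ?muln_gt0 ?a0 ?b0 //.
by rewrite !natrM -mulf_div; apply: semigroup3x1_mul.
Qed.

Lemma leads_trans b a c : leads a b -> leads b c -> leads a c.
Proof.
move=> lab lbc; have [[a0 b0 _] [_ c0 _]] := (lab, lbc).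
by apply: leads_eq (leads_mul lab lbc) => //; lia.
Qed.

Lemma leads_double n : 0 < n -> leads (2 * n) n /\ leads n (2 * n).
Proof.
move=> n0; split.
  apply: (@leads_eq 2 1); rewrite ?muln_gt0 //; first by rewrite mul1n.
  by split=> //; rewrite divr1; apply: semigroup3x1_gen; left.
apply: (@leads_eq 1 2); rewrite ?muln_gt0 //; first by rewrite mul1n.
by split=> //; apply: semigroup3x1_gen; right; exists 0.
Qed.

Lemma leads_refl n : 0 < n -> leads n n.
Proof. by case/leads_double=> l1 l2; apply: leads_trans l2 l1. Qed.

Lemma leads_scale c a b : 0 < c -> leads a b -> leads (c * a) (c * b).
Proof. by move=> c0; apply: leads_mul; apply: leads_refl. Qed.

(** Only the quotient matters, so common factors may be cancelled.  This is how
    a relation between composite numbers yields one between primes. *)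
Lemma leads_cancel c a b : leads (c * a) (c * b) -> leads a b.
Proof.
move=> l; have [] := l; rewrite !muln_gt0 => /andP[c0 a0] /andP[_ b0] _.
by apply: leads_eq l => //; lia.
Qed.

Lemma leads_pow2 v n : 0 < n -> leads (2 ^ v * n) n.
Proof.
move=> n0; elim: v => [|v IH]; first by rewrite mul1n; apply: leads_refl.
apply: leads_trans IH; rewrite expnS -mulnA.
by case: (@leads_double (2 ^ v * n)); rewrite // muln_gt0 expn_gt0.
Qed.

(** For n = 2k + 1 the generator is n / (3k + 2), and 3n + 1 = 2(3k + 2). *)
Lemma leads_3x1 n : odd n -> leads n (3 * n + 1).
Proof.
move=> on; have n0 : 0 < n by lia.
have [k en] : exists k, n = 2 * k + 1 by exists n./2; lia.
apply: (@leads_trans (3 * k + 2)); last first.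
  rewrite (_ : 3 * n + 1 = 2 * (3 * k + 2)); last lia.
  by case: (@leads_double (3 * k + 2)) => //; lia.
split=> //; first lia.
by apply: semigroup3x1_gen; right; exists k; rewrite en.
Qed.

(** A Collatz step accelerated by a wild multiplier: x -> xm -> 3xm + 1, followed
    by halvings. *)
Lemma leads_step m v x y :
  odd (x * m) -> leads 1 m -> 3 * (x * m) + 1 = 2 ^ v * y -> leads x y.
Proof.
move=> o l1 e; have x0 : 0 < x by lia.
have y0 : 0 < y by case: y e => //; rewrite muln0; lia.
apply: (@leads_trans (x * m)).
  by have := leads_scale x0 l1; rewrite muln1.
by apply: leads_trans (leads_3x1 o) _; rewrite e; apply: leads_pow2.
Qed.

(** The way wildness is produced: 1 -> d -> 3d + 1 = nM -> n, where tameness of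
    the cofactor M makes it disappear. *)
Lemma wild_of_multiple d n M :
  odd d -> leads 1 d -> 3 * d + 1 = n * M -> leads M 1 -> leads 1 n.
Proof.
move=> od l1 e lM; apply: leads_trans l1 _; apply: leads_trans (leads_3x1 od) _.
have n0 : 0 < n by case: n e => //; lia.
by rewrite e; have := leads_scale n0 lM; rewrite muln1.
Qed.

Lemma wild_mul a b : leads 1 a -> leads 1 b -> leads 1 (a * b).
Proof. by move=> la lb; have := leads_mul la lb; rewrite muln1. Qed.

(** * Explicit wild numbers *)

Lemma leads_5_7_11_17_13_5 :
  [/\ leads 5 7, leads 7 11, leads 11 17, leads 17 13 & leads 13 5].
Proof.
have w1 : leads 1 1 by apply: leads_refl.
have l7 : leads 7 11 by apply: (@leads_step 1 1).
have l11 : leads 11 17 by apply: (@leads_step 1 1).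
have l17 : leads 17 13 by apply: (@leads_step 1 2).
have l13 : leads 13 5 by apply: (@leads_step 1 3).
(* 7 * 5 -> 13 * 5 = 65, and 3 * 65 + 1 = 4 * (7 * 7) *)
split=> //; apply: (@leads_cancel 7); apply: (@leads_trans (5 * 13)).
  rewrite mulnC; apply: leads_scale => //.
  by apply: leads_trans l7 _; apply: leads_trans l11 _.
by apply: (@leads_step 1 2).
Qed.

(** Along the cycle 5^3 -> 7 * 7 * 17 = 833, and 3 * 833 + 1 = 4 * 5^4; cancel
    5^3. *)
Lemma wild5 : leads 1 5.
Proof.
have [l5 l7 l11 l17 l13] := leads_5_7_11_17_13_5.
apply: (@leads_cancel (5 * 5 * 5)); apply: (@leads_trans (7 * 7 * 17)).
  rewrite muln1; apply: leads_mul; first exact: leads_mul.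
  by apply: leads_trans l5 _; apply: leads_trans l7 _.
by apply: (@leads_step 1 2) => //; apply: leads_refl.
Qed.

Lemma wild7 : leads 1 7.
Proof. by apply: leads_trans wild5 _; case: leads_5_7_11_17_13_5. Qed.

Lemma wild11 : leads 1 11.
Proof. by apply: leads_trans wild7 _; case: leads_5_7_11_17_13_5. Qed.

Lemma wild13 : leads 1 13.
Proof.
have [l5 l7 l11 l17 l13] := leads_5_7_11_17_13_5.
by apply: leads_trans wild11 _; apply: leads_trans l11 _.
Qed.

Lemma tame5 : leads 5 1.
Proof. by apply: (@leads_step 1 4) => //; apply: leads_refl. Qed.

Lemma tame13 : leads 13 1.
Proof. by apply: leads_trans tame5; case: leads_5_7_11_17_13_5. Qed.

Lemma tame_pow2 v : leads (2 ^ v) 1.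
Proof. by have := @leads_pow2 v 1 isT; rewrite muln1. Qed.

(** 19, 23 and 43 are multipliers of the descent modulo 1024; 43, 683 and 2731
    are (2^k + 1)/3 for k = 7, 11, 13; 29 and 41 are steps towards 2731. *)
Lemma wild19 : leads 1 19.
Proof.
apply: (@wild_of_multiple (5 * 5) 19 (2 ^ 2)) => //; last exact: tame_pow2.
exact: wild_mul wild5 wild5.
Qed.

Lemma wild23 : leads 1 23.
Proof.
apply: (@wild_of_multiple (5 * 7 * 7) 23 (2 ^ 5)) => //; last exact: tame_pow2.
exact: wild_mul (wild_mul wild5 wild7) wild7.
Qed.

Lemma wild29 : leads 1 29.
Proof.
apply: (@wild_of_multiple (7 * 11) 29 (2 ^ 3)) => //; last exact: tame_pow2.
exact: wild_mul wild7 wild11.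
Qed.

Lemma wild41 : leads 1 41.
Proof.
apply: (@wild_of_multiple (7 * 7 * 29) 41 (2 ^ 3 * 13)) => //.
  exact: wild_mul (wild_mul wild7 wild7) wild29.
exact: leads_trans (leads_pow2 3 _) tame13.
Qed.

Lemma wild43 : leads 1 43.
Proof.
apply: (@wild_of_multiple (11 * 13) 43 (2 ^ 1 * 5)) => //.
  exact: wild_mul wild11 wild13.
exact: leads_trans (leads_pow2 1 _) tame5.
Qed.

Lemma wild683 : leads 1 683.
Proof.
apply: (@wild_of_multiple (5 * 7 * 13) 683 (2 ^ 1)) => //; last exact: tame_pow2.
exact: wild_mul (wild_mul wild5 wild7) wild13.
Qed.

Lemma wild2731 : leads 1 2731.
Proof.
apply: (@wild_of_multiple (7 * 7 * 29 * 41) 2731 (2 ^ 6)).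
- by rewrite !oddM.
- exact: wild_mul (wild_mul (wild_mul wild7 wild7) wild29) wild41.
- lia.
- exact: tame_pow2.
Qed.

(** * Descent outside the class of -1 modulo 1024 *)

(** A certificate for a residue class r + pZ, with p a power of 2.  [Split] cuts
    the class into two classes modulo 2p.  [Descend] lists pairs (m, v), to be
    used as accelerated steps x |-> (3xm + 1) / 2^v.  Binary numbers keep the
    verification cheap. *)
Inductive descent_tree :=
| Even
| MinusOne
| Descend of seq (N * N)
| Split of descent_tree & descent_tree.

(** 35 = 5 * 7; the other entries are 1 and wild primes. *)
Definition wild_multipliers : seq N := [:: 1; 5; 7; 11; 13; 19; 23; 35; 43]%num.

(** Applies a chain to the affine form a t + b, uniformly in t: the tests ensure
    that a t + b is odd and that 2^v divides 3 (a t + b) m + 1 for every t. *)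
Fixpoint run (chain : seq (N * N)) (a b : N) : option (N * N) :=
  if chain is (m, v) :: chain' then
    let p := N.pow 2 v in
    let a3 := N.mul 3 (N.mul a m) in
    let b3 := N.add (N.mul 3 (N.mul b m)) 1 in
    if [&& m \in wild_multipliers, N.eqb (N.modulo a 2) 0,
           N.eqb (N.modulo b 2) 1, N.eqb (N.modulo a3 p) 0
         & N.eqb (N.modulo b3 p) 0]
    then run chain' (N.div a3 p) (N.div b3 p) else None
  else Some (a, b).

(** With a < p and b < r, the chain decreases every p t + r.  The exception
    b = r = 1 allows for the fixed point 1 of the class of 1 modulo 4, where only
    t > 0 gives a smaller number. *)
Fixpoint check (p r : N) (T : descent_tree) : bool :=
  match T with
  | Even => N.eqb (N.modulo p 2) 0 && N.eqb (N.modulo r 2) 0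
  | MinusOne => N.eqb p 1024 && N.eqb r 1023
  | Descend chain =>
      if run chain p r is Some (a, b) then
        N.ltb a p && (N.ltb b r || (N.eqb b 1 && N.eqb r 1))
      else false
  | Split T0 T1 => check (N.mul 2 p) r T0 && check (N.mul 2 p) (N.add p r) T1
  end.

(** The chains come from a computer search.  The delicate classes are those near
    -1 and -5, which are periodic under the Collatz map.  Near -1, use 11 and 43,
    as 3 * 11 = 2^5 + 1 and 3 * 43 = 2^7 + 1; near -5, use 23, as the accelerated
    step takes -5 to -43 and 3 * 43 - 1 = 2^7. *)
Definition tree1024 : descent_tree :=
  (Split Even
   (Split (Descend [:: (1, 2)])
    (Split (Split (Descend [:: (1, 1); (1, 3)])
      (Split (Descend [:: (1, 1); (1, 2); (1, 2)])
       (Split (Split (Descend [:: (1, 1); (13, 6)])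
         (Split (Split (Split (Descend [:: (19, 2); (5, 8)])
            (Descend [:: (1, 1); (1, 2); (35, 7)]))
           (Descend [:: (1, 1); (5, 3); (1, 2); (1, 3)]))
          (Descend [:: (1, 1); (1, 2); (1, 1); (1, 1); (1, 3)])))
        (Split (Descend [:: (1, 1); (1, 2); (1, 1); (1, 3)])
         (Split (Descend [:: (1, 1); (1, 2); (1, 1); (1, 2); (1, 2)])
          (Descend [:: (23, 3); (1, 5)]))))))
     (Split (Split (Split (Descend [:: (5, 1); (1, 5)])
        (Split (Descend [:: (35, 7)])
         (Split (Split (Descend [:: (1, 1); (1, 1); (13, 7)])
           (Descend [:: (35, 6); (1, 3)]))
          (Descend [:: (5, 1); (1, 4); (1, 3)]))))
       (Descend [:: (1, 1); (1, 1); (1, 3)]))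
      (Split (Split (Split (Descend [:: (1, 1); (1, 1); (1, 1); (1, 4)])
         (Split (Descend [:: (1, 1); (19, 7)])
          (Descend [:: (5, 1); (5, 7)])))
        (Split (Descend [:: (13, 1); (1, 6)])
         (Descend [:: (11, 4); (1, 3)])))
       (Split (Descend [:: (11, 6)])
        (Split (Descend [:: (1, 1); (11, 6)])
         (Split (Descend [:: (43, 8)])
          (Split (Descend [:: (1, 1); (43, 8)])
           (Split (Split (Descend [:: (1, 1); (43, 7); (1, 3)])
             (Split (Descend [:: (1, 1); (43, 7); (1, 2); (1, 2)])
              (Descend [:: (11, 5); (11, 4); (1, 3)])))
            MinusOne))))))))))%num.

Lemma tree1024_check : check 1 0 tree1024.
Proof. by vm_compute. Qed.

Lemma wild_multipliersP m : m \in wild_multipliers -> leads 1 (N.to_nat m).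
Proof.
rewrite !inE; do !case/orP; move=> /eqP->.
- exact: leads_refl.
- exact: wild5.
- exact: wild7.
- exact: wild11.
- exact: wild13.
- exact: wild19.
- exact: wild23.
- exact: wild_mul wild5 wild7.
- exact: wild43.
Qed.

Lemma wild_multipliers_odd m : m \in wild_multipliers -> odd (N.to_nat m).
Proof. by rewrite !inE; do !case/orP; move=> /eqP->. Qed.

Lemma even_toN (a : N) : N.modulo a 2 = 0%num -> exists x, N.to_nat a = 2 * x.
Proof.
move=> a2; exists (N.to_nat (N.div a 2)).
by have := N.div_mod' a 2; rewrite a2; lia.
Qed.

Lemma odd_toN (a : N) : N.modulo a 2 = 1%num -> odd (N.to_nat a).
Proof. by move=> a2; have := N.div_mod' a 2; rewrite a2; lia. Qed.

Lemma run_leads chain (a b a' b' : N) (t : nat) :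
  run chain a b = Some (a', b') -> N.to_nat a * t + N.to_nat b > 0 ->
  leads (N.to_nat a * t + N.to_nat b) (N.to_nat a' * t + N.to_nat b').
Proof.
elim: chain a b => [|[m v] chain IH] a b.
  by case=> -> -> ?; apply: leads_refl.
rewrite /run -/run; set p := N.pow 2 v.
set a3 := N.mul 3 _; set b3 := N.add _ 1.
case: ifP => // /and5P[mw /N.eqb_eq a2 /N.eqb_eq b2 /N.eqb_eq ap /N.eqb_eq bp] run' pos.
have p0 : p <> 0%num by apply: N.pow_nonzero.
have ea := N.div_mod a3 p p0; have eb := N.div_mod b3 p p0.
move: run' ea eb; set a1 := N.div a3 p; set b1 := N.div b3 p.
rewrite ap bp !N.add_0_r => run' ea eb.
have mo := wild_multipliers_odd mw.
have pE : N.to_nat p = 2 ^ N.to_nat v by rewrite /p; lia.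
have xo : odd ((N.to_nat a * t + N.to_nat b) * N.to_nat m).
  by have [x ->] := even_toN a2; have := odd_toN b2; rewrite oddM mo; lia.
have step : leads (N.to_nat a * t + N.to_nat b) (N.to_nat a1 * t + N.to_nat b1).
  apply: (leads_step xo (wild_multipliersP mw)) (_ : _ = 2 ^ N.to_nat v * _).
  have {}ea : 3 * (N.to_nat a * N.to_nat m) = N.to_nat p * N.to_nat a1 by lia.
  have {}eb : 3 * (N.to_nat b * N.to_nat m) + 1 = N.to_nat p * N.to_nat b1 by lia.
  transitivity (3 * (N.to_nat a * N.to_nat m) * t
                + (3 * (N.to_nat b * N.to_nat m) + 1)); first by ring.
  by rewrite ea eb pE; ring.
by apply: (leads_trans step); apply: IH run' _; case: step.
Qed.

Lemma check_descends T p r n t :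
  check p r T -> n = N.to_nat p * t + N.to_nat r -> 1 < n -> odd n ->
  n = 1023 %[mod 1024] \/ exists2 n', n' < n & leads n n'.
Proof.
elim: T p r t => [||chain|T0 IH0 T1 IH1] p r t /=.
- case/andP=> /N.eqb_eq p2 /N.eqb_eq r2 en _.
  by have [[x ep] [y er]] := (even_toN p2, even_toN r2); rewrite en ep er; lia.
- by case/andP=> /N.eqb_eq-> /N.eqb_eq-> -> _ _; left; lia.
- case e: run => [[a b]|//] /andP[lt_ap ltb] en n1 _; right.
  exists (N.to_nat a * t + N.to_nat b); last by rewrite en; apply: run_leads e _; lia.
  have : N.to_nat a * t <= N.to_nat p * t by rewrite leq_mul2r; lia.
  case/orP: ltb => [|/andP[/N.eqb_eq eb /N.eqb_eq er]]; first lia.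
  case: t en => [|t] en; first by rewrite en er in n1; lia.
  have : N.to_nat a * t.+1 < N.to_nat p * t.+1 by rewrite ltn_mul2r; lia.
  lia.
- case/andP=> c0 c1 en; have [k [et|et]] : exists k, t = 2 * k \/ t = 2 * k + 1.
  + by exists t./2; lia.
  + by apply: (IH0 _ _ k c0); rewrite en et (N2Nat.inj_mul 2 p : _ = 2 * _); ring.
  + by apply: (IH1 _ _ k c1); 
    rewrite en et (N2Nat.inj_mul 2 p : _ = 2 * _) (N2Nat.inj_add p r : _ = _ + _); ring.
Qed.

Lemma descends_mod1024 n :
  1 < n -> odd n -> n != 1023 %[mod 1024] -> exists2 n', n' < n & leads n n'.
Proof.
move=> n1 on n1023; have [|/eqP|//] := check_descends (t := n) tree1024_check _ n1 on.
  by rewrite mul1n addn0.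
by rewrite (negPf n1023).
Qed.

(** * Descent near -1 in the 2-adic integers *)

Definition peelable (k : nat) : Prop :=
  exists m, [/\ 0 < k, 3 * m = 2 ^ k + 1 & leads 1 m].

Definition unit_mod6 (k : nat) : bool := (k %% 6 == 1) || (k %% 6 == 5).

(** 2 has order 6 modulo 9, and 2^k = -1 modulo 9 exactly when k = 3 modulo 6;
    so the odd exponents prime to 3 are those for which (2^k + 1)/3 is an integer
    prime to 3. *)
Lemma third_of_pow2S k :
  unit_mod6 k -> exists m, [/\ 3 * m = 2 ^ k + 1 & ~~ (3 %| m)].
Proof.
move=> kP; have e64 a r : 2 ^ (6 * a + r) = 2 ^ r %[mod 9].
  by rewrite expnD expnM -modnMml -modnXm (_ : 2 ^ 6 %% 9 = 1) // exp1n mul1n.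
have : 2 ^ k %% 9 = 2 \/ 2 ^ k %% 9 = 5.
  rewrite (divn_eq k 6) mulnC; case/orP: kP => /eqP->; rewrite e64; by [left|right].
by exists ((2 ^ k + 1) %/ 3); split; lia.
Qed.

(** With 3m = 2^k + 1 and x = 2^k u - 1 one has 3xm + 1 = 2^k (x + u). *)
Lemma leads_peel k u :
  peelable k -> 0 < u -> leads (2 ^ k * u - 1) ((2 ^ k + 1) * u - 1).
Proof.
move=> [m [k0 em lm]] u0; have even2k : ~~ odd (2 ^ k).
  by rewrite oddX negb_or -lt0n k0.
have mo : odd m by have := congr1 odd em; rewrite oddM oddD (negPf even2k).
move: em even2k; set q := 2 ^ k => em even2k.
have q0 : 0 < q by rewrite expn_gt0.
have [x ex] : exists x, q * u = x + 1.
  by exists (q * u - 1); rewrite subnK // muln_gt0 q0.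
have xo : odd x.
  by have := congr1 odd ex; rewrite oddM oddD (negPf even2k) /=; case: odd.
rewrite mulnDl mul1n ex addnK (_ : x + 1 + u - 1 = x + u); last lia.
apply: (@leads_step m k) => //; first by rewrite oddM xo.
rewrite -/q mulnCA em !mulnDr muln1 ex; lia.
Qed.

Definition peel_factor (ks : seq nat) := \prod_(k <- ks) (2 ^ k + 1).

Lemma leads_peels ks u :
  {in ks, forall k, peelable k} -> 1 < 2 ^ sumn ks * u ->
  leads (2 ^ sumn ks * u - 1) (peel_factor ks * u - 1).
Proof.
elim: ks u => [|k ks IH] u pk.
  by rewrite /peel_factor big_nil !mul1n => u1; apply: leads_refl; lia.
rewrite /peel_factor big_cons -/(peel_factor ks) /= expnD -mulnA => lt1.
have u0 : 0 < u by case: u lt1; rewrite ?muln0.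
have z0 : 0 < 2 ^ sumn ks * u by rewrite muln_gt0 expn_gt0.
apply: leads_trans (leads_peel (pk k (mem_head _ _)) z0) _.
rewrite mulnCA [_ * peel_factor ks]mulnC -mulnA; apply: IH.
  by move=> x xks; apply: pk; rewrite inE xks orbT.
rewrite mulnCA mulnDl mul1n; have : 0 < 2 ^ k by rewrite expn_gt0.
by move: z0; case: (2 ^ sumn ks * u) => // z _; case: (2 ^ k) => //; lia.
Qed.

(** A form of (1 + 1/32)^s <= 1 / (1 - s/32) that avoids large powers of 33.
    The induction step is (q + 1)(31 - s) <= q (32 - s), valid for q >= 31. *)
Lemma peel_factor_bound ks :
  all (leq 5) ks -> peel_factor ks * (32 - size ks) <= 32 * 2 ^ sumn ks.
Proof.
elim: ks => [|k ks IH] /=; first by rewrite /peel_factor big_nil.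
case/andP=> k5 /IH {}IH; rewrite /peel_factor big_cons -/(peel_factor ks) expnD.
have q32 : 2 ^ 5 <= 2 ^ k by rewrite leq_exp2l.
move: q32 IH; set q := 2 ^ k; set s := size ks; set P := peel_factor ks.
rewrite (_ : 2 ^ 5 = 32) // => q32 IH.
have : (q + 1) * (32 - s.+1) <= q * (32 - s) by nia.
move=> /(leq_mul (leqnn P)); move: (leq_mul (leqnn q) IH); lia.
Qed.

(** Exponents 1 are avoided, since a single one would cost a factor 3/2. *)
Lemma split_tail j : 10 <= j ->
  exists ks, [/\ sumn ks = j, size ks <= 3
    & {in ks, forall k, 5 <= k <= j /\ unit_mod6 k}].
Proof.
move=> j10; have : j %% 6 < 6 by rewrite ltn_mod.
case e: (j %% 6) => [|[|[|[|[|[|]]]]]] // _.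
- exists [:: 5; j - 5]; split=> //=; first lia.
  by move=> k; rewrite !inE /unit_mod6 => /orP[]/eqP->; lia.
- exists [:: j]; split=> //=; first lia.
  by move=> k; rewrite !inE /unit_mod6 => /eqP->; lia.
- exists [:: 7; j - 7]; split=> //=; first lia.
  by move=> k; rewrite !inE /unit_mod6 => /orP[]/eqP->; lia.
- exists [:: 5; 5; j - 10]; split=> //=; first lia.
  by move=> k; rewrite !inE /unit_mod6 => /or3P[]/eqP->; lia.
- exists [:: 5; j - 5]; split=> //=; first lia.
  by move=> k; rewrite !inE /unit_mod6 => /orP[]/eqP->; lia.
- exists [:: j]; split=> //=; first lia.
  by move=> k; rewrite !inE /unit_mod6 => /eqP->; lia.
Qed.

(** At most 12 copies of K, then at most 3 exponents for the remainder, which is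
    kept in [10, K + 10) so that [split_tail] applies. *)
Lemma split_exponent K j : 5 <= K -> unit_mod6 K -> 10 <= j <= 12 * K + 10 ->
  exists ks, [/\ sumn ks = j, size ks <= 15
    & {in ks, forall k, 5 <= k < K + 10 /\ unit_mod6 k}].
Proof.
move=> K5 K6 /andP[j10 jK]; pose t := (j - 10) %/ K.
have ej : j = K * t + (j - K * t) /\ (10 <= j - K * t) && (j - K * t < 10 + K).
  by have := divn_eq (j - 10) K; have := @ltn_pmod (j - 10) K; rewrite -/t; lia.
have [ks [sks zks kks]] := split_tail (proj1 (andP (proj2 ej))).
exists (nseq t K ++ ks); split.
- by rewrite sumn_cat sumn_nseq sks; lia.
- have : t <= 12 by rewrite -ltnS ltn_divLR; lia.
  by rewrite size_cat size_nseq; lia.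
- move=> k; rewrite mem_cat mem_nseq => /orP[/andP[_ /eqP->]|/kks[]]; first lia.
  by split=> //; lia.
Qed.

Lemma tame_of_peelable K :
  5 <= K -> unit_mod6 K ->
  (forall k, 5 <= k < K + 10 -> unit_mod6 k -> peelable k) ->
  forall n, 0 < n < 2 ^ (12 * K + 10) -> leads n 1.
Proof.
move=> K5 K6 wK; elim/ltn_ind=> n IH /andP[n0 nB].
have [->|n1] := eqVneq n 1; first exact: leads_refl.
have {n1} n1 : 1 < n by lia.
suff [n' n'n l] : exists2 n', n' < n & leads n n'.
  by apply: (leads_trans l); apply: IH => //; case: l => _ -> _; apply: ltn_trans nB.
have [on|en] := boolP (odd n); last first.
  have [m em] : exists m, n = 2 * m by exists n./2; lia.
  have m0 : 0 < m by lia.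
  by exists m; [lia | rewrite em; case: (leads_double m0)].
have [e1023|] := eqVneq (n %% 1024) (1023 %% 1024); last exact: descends_mod1024.
have j10 : 10 <= logn 2 (n + 1) by rewrite -pfactor_dvdn ?addn1 //; lia.
have [u] := pfactor_coprime (isT : prime 2) (ltn_addl n (ltnSn 0)).
rewrite coprime2n; move: j10; set j := logn 2 _ => j10 uo eu.
have u0 : 0 < u by case: u uo {eu}.
have jB : j <= 12 * K + 10.
  rewrite -(@leq_exp2l 2) //; apply: leq_trans (_ : n + 1 <= _); last by rewrite addn1.
  by rewrite eu leq_pmull.
have [ks [sks z15 kks]] := split_exponent K5 K6 (introT andP (conj j10 jB)).
have pks : {in ks, forall k, peelable k} by move=> k /kks[]; apply: wK.
have := leads_peels (u := u) pks; rewrite sks [2 ^ j * u]mulnC -eu addnK => l.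
have bound : peel_factor ks * (32 - size ks) <= 32 * 2 ^ sumn ks.
  by apply: peel_factor_bound; apply/allP => k /kks[/andP[]].
have j1024 : 2 ^ 10 <= 2 ^ j by rewrite leq_exp2l.
have oP : odd (peel_factor ks).
  rewrite /peel_factor big_seq; elim/big_rec: _ => // k x /kks[k5 _] ox.
  by rewrite oddM oddD oddX ox /= orbF; case: k k5.
have o2 : odd (peel_factor ks * u) by rewrite oddM oP.
(* at most 15 exponents, hence 32 - 15 = 17 *)
have {}bound : 17 * (peel_factor ks * u) <= 32 * (n + 1).
  apply: leq_trans (_ : peel_factor ks * (32 - size ks) * u <= _).
    by rewrite [17 * _]mulnC mulnAC; do 2!apply: leq_mul => //; lia.
  by rewrite eu [u * _]mulnC mulnA -sks leq_mul2r bound orbT.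
have n1024 : 1024 <= n + 1 by rewrite eu (leq_trans j1024) // leq_pmull.
have {}l := l (leq_trans (isT : 1 < 1024) n1024).
move: l o2 bound; set Q := peel_factor ks * u => l o2 bound.
have [y ey] : exists y, Q - 1 = 2 * y by exists (Q - 1)./2; lia.
have y0 : 0 < y by case: l => _; lia.
exists y; first lia.
by apply: (leads_trans l); rewrite ey; case: (leads_double y0).
Qed.

(** * Products of small wild numbers congruent to -1/3 *)

(** The fraction b/c modulo n is the residue of an odd wild number d <= n^l,
    where l counts the factors below n used to build d. *)
Definition represents (n l : nat) (b : int) (c : nat) : Prop :=
  exists d, [/\ coprime n c, odd d, leads 1 d, d <= n ^ l
              & (n%:Z %| ((c * d)%N%:Z - b)%R)%Z].

Lemma represents_mul n l1 b1 c1 l2 b2 c2 :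
  represents n l1 b1 c1 -> represents n l2 b2 c2 ->
  represents n (l1 + l2) (b1 * b2)%R (c1 * c2).
Proof.
move=> [d1 [nc1 o1 w1 B1 D1]] [d2 [nc2 o2 w2 B2 D2]]; exists (d1 * d2); split.
- by rewrite coprimeMr nc1.
- by rewrite oddM o1.
- exact: wild_mul.
- by rewrite expnD leq_mul.
- have -> : ((c1 * c2 * (d1 * d2))%N%:Z - b1 * b2
     = (c1 * d1)%N%:Z * ((c2 * d2)%N%:Z - b2) + ((c1 * d1)%N%:Z - b1) * b2)%R.
    by rewrite !PoszM; ring.
  by apply: rpredD; [apply: dvdz_mull | apply: dvdz_mulr].
Qed.

Lemma multiple_of_represents n l b c :
  represents n l b c -> (3 * b = - c%:Z)%R ->
  exists d M, [/\ odd d, leads 1 d, d <= n ^ l & 3 * d + 1 = n * M].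
Proof.
move=> [d [nc od wd Bd Dd]] ebc.
have : (n%:Z %| (c%:Z * (3 * d + 1)%N%:Z)%R)%Z.
  have -> : (c%:Z * (3 * d + 1)%N%:Z = 3 * ((c * d)%N%:Z - b))%R.
    by rewrite mulrBr ebc PoszD !PoszM; ring.
  exact: dvdz_mull.
rewrite Gauss_dvdzr // => /dvdnP[M eM].
by exists d, M; split=> //; rewrite [n * M]mulnC.
Qed.

(** Each factor is r = (a n + b)/c, which represents b/c, with constants a, b, c
    chosen so that r is an integer prime to 6 under the congruences at hand.  The
    fractions available in this way depend on n modulo 8 and 27; in each case
    -1/3 is a product of at most 5 of them. *)
Lemma represents_third n :
  16 < n -> odd n -> ~~ (3 %| n) ->
  (forall m, 0 < m < n -> ~~ (3 %| m) -> leads 1 m) ->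
  exists l b c, [/\ l <= 5, represents n l b c & (3 * b = - c%:Z)%R].
Proof.
move=> n16 on n3 IH.
have rep r (a b : int) c : c %| 36 -> [&& odd r, r < n & ~~ (3 %| r)] ->
    ((c * r)%N%:Z = a * n%:Z + b)%R -> represents n 1 b c.
  move=> c36 /and3P[or ltr r3] e; exists r; split=> //.
  - apply: coprime_dvdr c36 _; rewrite (_ : 36 = 2 ^ 2 * 3 ^ 2) // coprimeMr.
    by rewrite !coprimeXr // coprime_sym ?coprime2n // prime_coprime.
  - by apply: IH => //; lia.
  - by rewrite expn1 ltnW.
  - by rewrite e addrK dvdz_mull.
have third l b c : l <= 5 -> represents n l b c -> (3 * b = - c%:Z)%R ->
    exists l b c, [/\ l <= 5, represents n l b c & (3 * b = - c%:Z)%R].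
  by exists l, b, c.
have [n1|n2] : n %% 3 = 1 \/ n %% 3 = 2 by lia.
- have [n9|n9] := eqVneq (n %% 9) 4; last first.
  + have h3 : represents n 1 1 3 by apply: (rep ((2 * n + 1) %/ 3) 2%R); lia.
    have h1 : represents n 1 (-2) 1 by apply: (rep (n - 2) 1%R); lia.
    have [n4|n4] : n %% 4 = 1 \/ n %% 4 = 3 by lia.
    * have h2 : represents n 1 1 2 by apply: (rep ((n + 1) %/ 2) 1%R); lia.
      (* -2 * (1/2) * (1/3) *)
      exact: (third _ _ _ _ (represents_mul (represents_mul h1 h2) h3)).
    * have h2 : represents n 1 3 2 by apply: (rep ((n + 3) %/ 2) 1%R); lia.
      (* -2 * (3/2) * (1/3)^2 *)
      exact: (third _ _ _ _ (represents_mul (represents_mul h1 h2)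
                                            (represents_mul h3 h3))).
  + have h3 : represents n 1 (-16) 3 by apply: (rep ((n - 16) %/ 3) 1%R); lia.
    have [n4|[n8|n8]] : n %% 4 = 1 \/ (n %% 8 = 3 \/ n %% 8 = 7) by lia.
    * have h2 : represents n 1 1 2 by apply: (rep ((n + 1) %/ 2) 1%R); lia.
      have h4 := represents_mul h2 h2.
      (* (-16/3) * (1/2)^4 *)
      exact: (third _ _ _ _ (represents_mul h3 (represents_mul h4 h4))).
    * have h4 : represents n 1 1 4 by apply: (rep ((n + 1) %/ 4) 1%R); lia.
      (* (-16/3) * (1/4)^2 *)
      exact: (third _ _ _ _ (represents_mul h3 (represents_mul h4 h4))).
    * have h2 : represents n 1 3 2 by apply: (rep ((n + 3) %/ 2) 1%R); lia.
      have [n27|n27] := eqVneq (n %% 27) 13.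
        have h4 : represents n 1 (-3) 4 by apply: (rep ((n - 3) %/ 4) 1%R); lia.
        have h9 : represents n 1 (-4) 9 by apply: (rep ((n - 4) %/ 9) 1%R); lia.
        have h29 := represents_mul h2 h9.
        (* (-3/4) * ((3/2) * (-4/9))^2 *)
        exact: (third _ _ _ _ (represents_mul h4 (represents_mul h29 h29))).
      have h1 : represents n 1 (-2) 1 by apply: (rep (n - 2) 1%R); lia.
      have h9 : represents n 1 1 9 by apply: (rep ((2 * n + 1) %/ 9) 2%R); lia.
      (* -2 * (3/2) * (1/9) *)
      exact: (third _ _ _ _ (represents_mul (represents_mul h1 h2) h9)).
- have [n9|n9] := eqVneq (n %% 9) 5; last first.
    have h3 : represents n 1 (-1) 3 by apply: (rep ((2 * n - 1) %/ 3) 2%R); lia.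
    exact: (third _ _ _ _ h3).
  have [n4|[n8|n8]] : n %% 4 = 1 \/ (n %% 8 = 3 \/ n %% 8 = 7) by lia.
  + have h6 : represents n 1 1 6 by apply: (rep ((n + 1) %/ 6) 1%R); lia.
    have h1 : represents n 1 (-12) 1 by apply: (rep (n - 12) 1%R); lia.
    (* -12 * (1/6)^2 *)
    exact: (third _ _ _ _ (represents_mul h1 (represents_mul h6 h6))).
  + have h12 : represents n 1 1 12 by apply: (rep ((n + 1) %/ 12) 1%R); lia.
    have h1 : represents n 1 (-4) 1 by apply: (rep (n - 4) 1%R); lia.
    (* -4 * (1/12) *)
    exact: (third _ _ _ _ (represents_mul h1 h12)).
  + have h4 : represents n 1 (-3) 4 by apply: (rep ((n - 3) %/ 4) 1%R); lia.
    have h3 : represents n 1 (-2) 3 by apply: (rep ((n - 2) %/ 3) 1%R); lia.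
    (* (-3/4) * (-2/3)^2 *)
    exact: (third _ _ _ _ (represents_mul h4 (represents_mul h3 h3))).
Qed.

(** * The bootstrap *)

Lemma peelable7 k : 5 <= k < 7 + 10 -> unit_mod6 k -> peelable k.
Proof.
move=> kB k6; have : k \in [:: 5; 7; 11; 13].
  by move: k6; rewrite !inE /unit_mod6; lia.
rewrite !inE => /or4P[] /eqP->.
- by exists 11; split=> //; apply: wild11.
- by exists 43; split=> //; apply: wild43.
- by exists 683; split=> //; apply: wild683.
- by exists 2731; split; [| lia | apply: wild2731].
Qed.

(** Let 2^L <= n < 2^(L+1), so that 3 n^4 < 2^(4L + 6).  For L >= 23 let K be the
    largest integer at most L - 8 that is 1 modulo 6: the numbers (2^k + 1)/3 with
    k < K + 10 are below n, and 12 K + 10 >= 4 L + 6.  Smaller n are within reach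
    of the explicit wild numbers, with K = 7. *)
Lemma tame_of_wild_below n :
  16 < n -> (forall m, 0 < m < n -> ~~ (3 %| m) -> leads 1 m) ->
  forall M, 0 < M <= 3 * n ^ 4 -> leads M 1.
Proof.
move=> n16 IH M /andP[M0 MB]; pose L := trunc_log 2 n.
have [nL Ln] : n < 2 ^ L.+1 /\ 2 ^ L <= n.
  by split; [apply: trunc_log_ltn | apply: trunc_logP; lia].
have ML : M < 2 ^ (4 * L + 6).
  apply: leq_ltn_trans MB _.
  rewrite (_ : 4 * L + 6 = 2 + L.+1 * 4) ?expnD; last lia.
  by apply: ltn_mul => //; rewrite expnM ltn_exp2r.
have reach K : 5 <= K -> unit_mod6 K -> 4 * L + 6 <= 12 * K + 10 ->
    (forall k, 5 <= k < K + 10 -> unit_mod6 k -> peelable k) -> leads M 1.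
  move=> K5 K6 LK pk; apply: (tame_of_peelable K5 K6 pk).
  by rewrite M0 (leq_trans ML) // leq_exp2l.
have [L22|L22] := leqP L 22; first by apply: (reach 7) => //; [lia | exact: peelable7].
apply: (reach (6 * ((L - 9) %/ 6) + 1)); rewrite /unit_mod6; try lia.
move=> k kB k6; have [m [em m3]] := third_of_pow2S k6.
exists m; split=> //; first lia.
apply: IH => //; have : 2 ^ k <= 2 ^ L.+1 by rewrite leq_exp2l //; lia.
by rewrite expnS; lia.
Qed.

Lemma wild_all n : 0 < n -> ~~ (3 %| n) -> leads 1 n.
Proof.
elim/ltn_ind: n => n IH n0 n3.
have [on|en] := boolP (odd n); last first.
  have [m em] : exists m, n = 2 * m by exists n./2; lia.
  have m0 : 0 < m by lia.
  rewrite em; case: (leads_double m0) => _; apply: leads_trans.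
  by apply: IH; lia.
have [n16|n16] := leqP n 16.
  have : n \in [:: 1; 5; 7; 11; 13] by rewrite !inE; lia.
  rewrite !inE => /orP[/eqP->|/or4P[]/eqP->]; first exact: leads_refl.
  - exact: wild5.
  - exact: wild7.
  - exact: wild11.
  - exact: wild13.
have {}IH m : 0 < m < n -> ~~ (3 %| m) -> leads 1 m by case/andP=> m0 mn; apply: IH.
have [l [b [c [l5 rep ebc]]]] := represents_third n16 on n3 IH.
have [d [M [od wd dB e]]] := multiple_of_represents rep ebc.
apply: (wild_of_multiple od wd e); apply: (tame_of_wild_below n16 IH).
have M0 : 0 < M by case: M e => //; lia.
(* n M = 3 d + 1 <= 3 n^5 + 1 < n (3 n^4 + 1) *)
rewrite M0 -ltnS -(ltn_pmul2l n0) -e mulnS mulnCA -expnS.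
have : n ^ l <= n ^ 5 by rewrite leq_pexp2l.
by lia.
Qed.

(** Any K with n < 2^(12 K + 10) will do, now that all (2^k + 1)/3 are wild. *)
Lemma tame_all n : 0 < n -> leads n 1.
Proof.
move=> n0; apply: (@tame_of_peelable (6 * n + 1)); rewrite /unit_mod6; try lia.
  move=> k kB k6; have [m [em m3]] := third_of_pow2S k6.
  by exists m; split=> //; [lia | apply: wild_all; lia].
rewrite n0; apply: leq_trans (ltn_expl n (ltnSn 1)) _.
by rewrite leq_exp2l //; lia.
Qed.

Local Open Scope ring_scope.

(** 3 divides neither 1 nor any 3k + 2, and it is prime. *)
Lemma semigroup3x1_fraction x : semigroup3x1 x ->
  exists a b, [/\ (0 < a)%N, (0 < b)%N, ~~ (3 %| b)%N & x = a%:R / b%:R].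
Proof.
case=> s [_ Gs ->]; elim: s Gs => [|g s IH] Gs.
  by exists 1, 1; split=> //; rewrite big_nil divr1.
rewrite big_cons; have [|a [b [a0 b0 b3 ->]]] := IH.
  by move=> h hs; apply: Gs; rewrite inE hs orbT.
have [->|[k ->]] := Gs g (mem_head _ _).
  by exists (2 * a)%N, b; split; rewrite ?muln_gt0 ?natrM ?mulrA.
exists ((2 * k + 1) * a)%N, ((3 * k + 2) * b)%N.
rewrite !muln_gt0 a0 b0 !natrM mulf_div Euclid_dvdM // negb_or b3.
by split=> //; lia.
Qed.

Theorem theorem1p1 :
  (forall x : rat,
     semigroup3x1 x <->
     exists a b : nat,
       [/\ (0 < a)%N, (0 < b)%N, coprime a b, x = a%:R / b%:R
         & (b <> 0 %[mod 3])%N]) /\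
  (forall n : nat, (0 < n)%N -> semigroup3x1 n%:R).
Proof.
split=> [x|n n0]; last by have [_ _] := tame_all n0; rewrite divr1.
split=> [/semigroup3x1_fraction[a [b [a0 b0 b3 ->]]]|[a [b [a0 b0 _ -> b3]]]].
  have g0 : (0 < gcdn a b)%N by rewrite gcdn_gt0 a0.
  have b'0 : (0 < b %/ gcdn a b)%N by rewrite divn_gt0 // dvdn_leq // dvdn_gcdr.
  exists (a %/ gcdn a b)%N, (b %/ gcdn a b)%N; split=> //.
  - by rewrite divn_gt0 // dvdn_leq // dvdn_gcdl.
  - rewrite /coprime -(eqn_pmul2l g0) muln_gcdr muln1.
    by rewrite ![(gcdn a b * _)%N]mulnC !divnK ?dvdn_gcdl ?dvdn_gcdr.
  - apply/eqP; rewrite eqr_div ?natr_neq0 // -!natrM muln_divCA_gcd.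
    by rewrite mulnC.
  - rewrite mod0n => /eqP b'3; case/negP: b3.
    by rewrite -(divnK (dvdn_gcdr a b)) dvdn_mulr.
have b3' : ~~ (3 %| b)%N by apply/negP => /eqP b3'; apply: b3; rewrite b3'.
by have [_ _] := leads_trans (tame_all a0) (wild_all b0 b3').
Qed.
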